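(* For every $n\ge1$ and every $v\in\{0,1\}^n$, $$L_v(x;q,t)=\sum_{\substack{\gamma\in\overline{\mathcal{F}}_v\\ \pi\in\mathbb{P}^n}} q^{\operatorname{area}(\gamma)+\operatorname{bar}(\gamma)}\,t^{\overline{\operatorname{dinv}}(\gamma,\pi)}\,(1-q)^{-\operatorname{bar}(\gamma)-\chi(v=0^n)}\,x^\pi,$$ where $\chi(v=0^n)$ equals $1$ if $v=0^n$ and $0$ otherwise.
   Context: $\mathbb{N}=\{0,1,2,\dots\}$, $\mathbb{P}=\{1,2,3,\dots\}$, $x^\pi=\prod_i x_{\pi_i}$, $\operatorname{area}(\gamma)=|\gamma|-\#\{i:\gamma_i>0\}$ for $\gamma\in\mathbb{N}^n$ (bars are ignored), and $(1-q)^{-1}=\sum_{k\ge0}q^k$. For $v\in\{0,1\}^n$, $L_v(x;q,t)=\sum q^{\operatorname{area}(\gamma)}t^{\operatorname{dinv}(\gamma,\pi)}x^\pi$ summed over $\gamma\in\mathbb{N}^n$, $\pi\in\mathbb{P}^n$ with $\gamma_i=0\iff v_i=1$, where $\operatorname{dinv}(\gamma,\pi)=\#\{i<j:\gamma_i=\gamma_j,\ \pi_i>\pi_j\}+\#\{i<j:\gamma_i+1=\gamma_j,\ \pi_i<\pi_j\}$. A word $\gamma\in\mathbb{N}^n$ is a Fubini word if every integer $k$ with $0\le k\le\max(\gamma)$ appears in $\gamma$. A Fubini word $\gamma$ is associated with $v$ if either $v=0^n$ and the only entry of $\gamma$ equal to $0$ is $\gamma_1$, or $v\ne0^n$ and $\gamma_i=0\iff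 v_i=1$. A barred Fubini word associated with $v$ is such a $\gamma$ together with a choice of bars on some entries, where an entry $\gamma_j$ may be barred only if $\gamma_j>0$, the value $\gamma_j$ occurs exactly once in $\gamma$, and $\gamma_i<\gamma_j$ for all $i<j$. $\overline{\mathcal{F}}_v$ denotes the (finite) set of barred Fubini words associated with $v$, $\operatorname{bar}(\gamma)$ is the number of barred entries, and for $\pi\in\mathbb{P}^n$, $\overline{\operatorname{dinv}}(\gamma,\pi)=\#\{i<j:\gamma_i=\gamma_j,\ \pi_i>\pi_j\}+\#\{i<j:\gamma_i+1=\gamma_j,\ \pi_i<\pi_j,\ \gamma_j\text{ not barred}\}$. *)

(* Defs.v *)
From HB Require Import structures.
From mathcomp Require Import all_boot all_order all_algebra.
From mathcomp Require Import finmap.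
From mathcomp Require Import mathcomp_extra boolp classical_sets functions.
From mathcomp Require Import cardinality fsbigop.
From mathcomp Require Import monalg.

Set Implicit Arguments.
Unset Strict Implicit.
Unset Printing Implicit Defensive.

Import GRing.Theory.

Local Open Scope classical_set_scope.
Local Open Scope ring_scope.

Local Notation "x * y" := (mmul x y) : monom_scope.

Section Factors.
Context {I : choiceType}.
Implicit Types m a b : {cmonom I}.

Lemma finite_divisors m : finite_set [set a : {cmonom I} | exists b : {cmonom I}, (a * b)%M = m].
Proof.
pose N := (\max_(i : finsupp m) m (val i))%N.
pose g (h : {ffun finsupp m -> 'I_N.+1}) : {cmonom I} :=
  [cmonom (h i : nat) | i : finsupp m]%M.
apply: (@sub_finite_set _ _ (g @` [set: {ffun finsupp m -> 'I_N.+1}])).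
  move=> a [b ab].
  have am i : (a i <= m i)%N by rewrite -ab cmM leq_addr.
  pose h := [ffun i : finsupp m => inord (a (val i)) : 'I_N.+1].
  exists h => //; apply/eqP/cmP => i.
  rewrite /g cmE /= fsfun_ffun; case: insubP => [j _ ji|ni] /=.
    rewrite ffunE inordK ?ji // ltnS -ji.
    apply: leq_trans (leq_bigmax (F := fun i : finsupp m => m (val i)) j).
    exact: am.
  have : m i = 0%N by apply: fsfun_dflt.
  by move: (am i) => + mi; rewrite mi leqn0 => /eqP.
exact/finite_image/finite_finset.
Qed.

Lemma finite_factors m :
  finite_set [set p : {cmonom I} * {cmonom I} | (p.1 * p.2)%M = m].
Proof.
apply: (sub_finite_set _ (finite_setX (finite_divisors m) (finite_divisors m))).
by move=> [a b] /= ab; split; [exists b | exists a; rewrite mulmC].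
Qed.

End Factors.

(* Formal power series over R in the variables I, as families of coefficients.
   The product is the Cauchy product below, not the pointwise product that
   functions into a ring carry by default. *)
Definition fps (R : comNzRingType) (I : choiceType) := {cmonom I} -> R.

HB.instance Definition _ (R : comNzRingType) (I : choiceType) :=
  GRing.Zmodule.copy (fps R I) ({cmonom I} -> R).

Definition fps_monom (R : comNzRingType) (I : choiceType) (m : {cmonom I}) :
  fps R I := fun k => (k == m)%:R.

Definition fps_mul (R : comNzRingType) (I : choiceType) (f g : fps R I) :
    fps R I :=
  fun m => \sum_(p \in [set p : {cmonom I} * {cmonom I} | (p.1 * p.2)%M = m])
    (f p.1 * g p.2).

Section FpsRing.
Context {R : comNzRingType} {I : choiceType}.
Implicit Types (f g h : fps R I) (m : {cmonom I}).

Let divs m : seq {cmonom I} :=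
  fset_set [set a : {cmonom I} | exists b : {cmonom I}, (a * b)%M = m].

Let uniq_divs m : uniq (divs m). Proof. exact: fset_uniq. Qed.

Let mem_divs m a : a \in divs m <-> exists b : {cmonom I}, (a * b)%M = m.
Proof. by rewrite /divs /= in_fset_set ?inE //; apply: finite_divisors. Qed.

Let fps_mulE f g (r : seq {cmonom I}) m : uniq r ->
    (forall a b : {cmonom I}, (a * b)%M = m -> a \in r) ->
  fps_mul f g m =
    \sum_(a <- r) \sum_(b <- r) ((a * b)%M == m)%:R * (f a * g b).
Proof.
move=> ur rm; rewrite /fps_mul.
pose F (p : {cmonom I} * {cmonom I}) : R :=
  ((p.1 * p.2)%M == m)%:R * (f p.1 * g p.2).
rewrite (eq_fsbigr F); last first.
  by move=> p; rewrite inE /F /= => ->; rewrite eqxx mul1r.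
rewrite (fsbig_fwiden [seq (a, b) | a <- r, b <- r]) /=.
- by rewrite big_allpairs.
- move=> [a b] /= ab; apply/allpairsP; exists (a, b).
  by rewrite (rm a b ab) (rm b a) // mulmC.
- by apply: allpairs_uniq => // -[a b] [c d].
- by move=> p [_ /= /eqP/negPf pm]; rewrite /F pm mul0r.
Qed.

Let fps_mulC : commutative (@fps_mul R I).
Proof.
move=> f g; apply/funext => m.
have rm (a b : {cmonom I}) : (a * b)%M = m -> a \in divs m.
  by move=> ab; apply/mem_divs; exists b.
rewrite !(fps_mulE _ _ (uniq_divs m) rm) exchange_big /=.
by apply: eq_bigr => a _; apply: eq_bigr => b _; rewrite mulmC [f _ * _]mulrC.
Qed.

Let fps_mulE3 f g h m (r := divs m) :
  fps_mul f (fps_mul g h) m = \sum_(a <- r) \sum_(c <- r) \sum_(d <- r)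
    ((a * (c * d))%M == m)%:R * (f a * (g c * h d)).
Proof.
have ur : uniq r by exact: uniq_divs.
have rm (a b : {cmonom I}) : (a * b)%M = m -> a \in r.
  by move=> ab; apply/mem_divs; exists b.
rewrite (fps_mulE _ _ ur rm); apply: eq_bigr => a _.
transitivity (\sum_(b <- r) \sum_(c <- r) \sum_(d <- r)
   (((a * b)%M == m) && (b == (c * d)%M))%:R * (f a * (g c * h d))).
  apply: eq_bigr => b _; have [abm|_] := eqVneq (a * b)%M m; last first.
    rewrite mul0r big1 // => c _; rewrite big1 // => d _.
    by rewrite mul0r.
  rewrite mul1r (fps_mulE _ _ ur); last first.
    move=> c d cd; apply: (rm c (d * a)%M).
    by rewrite mulmA cd mulmC.
  rewrite mulr_sumr; apply: eq_bigr => c _.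
  rewrite mulr_sumr; apply: eq_bigr => d _ /=.
  by rewrite [RHS]mulrCA eq_sym.
rewrite exchange_big /=; apply: eq_bigr => c _.
rewrite exchange_big /=; apply: eq_bigr => d _.
rewrite -mulr_suml; congr (_ * _).
have [acd|acd] := eqVneq (a * (c * d))%M m.
  have cdr : (c * d)%M \in r by apply: (rm _ a); rewrite mulmC.
  rewrite (bigD1_seq _ cdr ur) /= acd !eqxx big1 ?addr0 // => b /negPf->.
  by rewrite andbF.
rewrite big1 // => b _; case: eqVneq => //= abm; case: eqVneq => // bcd.
by move: acd; rewrite -bcd abm eqxx.
Qed.

Let fps_mulA : associative (@fps_mul R I).
Proof.
move=> f g h; apply/funext => m.
rewrite [fps_mul (fps_mul f g) h]fps_mulC !fps_mulE3.
rewrite [RHS]exchange_big /=; apply: eq_bigr => a _.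
rewrite [RHS]exchange_big /=; apply: eq_bigr => c _; apply: eq_bigr => d _.
by rewrite [(d * (a * c))%M]mulmC -mulmA [h d * _]mulrC -[f a * g c * _]mulrA.
Qed.

Let fps_mul1 : left_id (fps_monom R mone) (@fps_mul R I).
Proof.
move=> f; apply/funext => m; rewrite /fps_mul.
rewrite -(fsbig_widen [set (mone : {cmonom I}, m)]).
- by rewrite fsbig_set1 /= /fps_monom eqxx mul1r.
- by move=> _ ->; rewrite /= mul1m.
- move=> [a b] [/= abm nab]; have [a1 | /negPf] := eqVneq a mone.
    by case: nab; rewrite -abm a1 mul1m.
  by rewrite /fps_monom => ->; rewrite mul0r.
Qed.

Let fps_mulDl : left_distributive (@fps_mul R I) +%R.
Proof.
move=> f g h; apply/funext => m; rewrite [RHS]/GRing.add /=.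
have rm (a b : {cmonom I}) : (a * b)%M = m -> a \in divs m.
  by move=> ab; apply/mem_divs; exists b.
rewrite !(fps_mulE _ _ (uniq_divs m) rm) -big_split /=.
apply: eq_bigr => a _; rewrite -big_split /=; apply: eq_bigr => b _.
by rewrite -mulrDr -mulrDl.
Qed.

Let fps_1neq0 : fps_monom R (mone : {cmonom I}) != 0.
Proof.
apply/eqP => /(congr1 (fun f : fps R I => f mone)) /eqP.
by rewrite /fps_monom eqxx (oner_eq0 R).
Qed.

HB.instance Definition _ := GRing.Zmodule_isComNzRing.Build (fps R I)
  fps_mulA fps_mulC fps_mul1 fps_mulDl fps_1neq0.

Lemma fps_mul_supp f g m : (f * g) m != 0 ->
  exists a b : {cmonom I}, [/\ (a * b)%M = m, f a != 0 & g b != 0].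
Proof.
move=> fgm; apply/not_existsP => nab; move/eqP: fgm; apply.
apply: fsbig1 => -[a b] /= abm; apply/eqP/negPn/negP => fg; apply: (nab a).
exists b; split=> //; apply: contraNN fg => /eqP->; rewrite ?mul0r ?mulr0 //.
Qed.

End FpsRing.

Definition fps_var (R : comNzRingType) (I : choiceType) (i : I) : fps R I :=
  fps_monom R (ucm i).

(* Sum of a possibly infinite family, coefficient by coefficient.  It is
   meaningful for summable families; the sum of infinitely many nonzero
   coefficients is 0 by convention. *)
Definition fps_summable (R : comNzRingType) (I J : choiceType) (A : set J)
    (F : J -> fps R I) : Prop :=
  forall m : {cmonom I}, finite_set [set j | A j /\ F j m != 0].

Definition fps_sum (R : comNzRingType) (I J : choiceType) (A : set J)
    (F : J -> fps R I) : fps R I :=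
  fun m => \sum_(j \in A) F j m.

Lemma fps_varX_supp (R : comNzRingType) (I : choiceType) (i : I) (k : nat)
  (m : {cmonom I}) : (fps_var R i ^+ k) m != 0 -> (k <= m i)%N.
Proof.
elim: k m => [//|k IHk] m; rewrite exprS.
move=> /fps_mul_supp[a [b [<- am /IHk kb]]]; rewrite cmM.
move: am; rewrite /fps_var /fps_monom; case: (eqVneq a (ucm i)) => [->|]; last by rewrite eqxx.
by rewrite cmUU.
Qed.

(* Vx k is the variable x_k; only k >= 1 occurs below. *)
Inductive var : Type := Vq | Vt | Vx of nat.

Definition var_code (u : var) : option (option nat) :=
  match u with
  | Vq => None
  | Vt => Some None
  | Vx k => Some (Some k)
  end.

Definition var_decode (c : option (option nat)) : var :=
  match c with
  | None => Vq
  | Some None => Vt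
  | Some (Some k) => Vx k
  end.

Lemma var_codeK : cancel var_code var_decode.
Proof. by case. Qed.

HB.instance Definition _ := Choice.copy var (can_type var_codeK).

Notation qtx_series := (fps int var).

Definition q_ : qtx_series := fps_var int Vq.
Definition t_ : qtx_series := fps_var int Vt.
Definition x_ (k : nat) : qtx_series := fps_var int (Vx k).

(* (1 - q)^-1, expanded as the geometric series. *)
Definition inv_1q : qtx_series := fps_sum [set: nat] (fun k => q_ ^+ k).

Notation word n := {ffun 'I_n -> nat}.

Section Words.
Context {n : nat}.
Implicit Types (gam pi : word n) (bars : {set 'I_n}) (v : {ffun 'I_n -> bool}).

Definition xpow pi : qtx_series := \prod_(i < n) x_ (pi i).

(* The truncated subtraction is exact: each positive entry is at least 1. *)
Definition area gam : nat :=
  ((\sum_(i < n) gam i) - #|[pred i | 0 < gam i]|)%N.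

Definition dinv gam pi : nat :=
  (#|[pred p : 'I_n * 'I_n |
       [&& p.1 < p.2, gam p.1 == gam p.2 & pi p.2 < pi p.1]]| +
   #|[pred p : 'I_n * 'I_n |
       [&& p.1 < p.2, (gam p.1 + 1)%N == gam p.2 & pi p.1 < pi p.2]]|)%N.

(* A barred word is a pair (gam, bars), bars being the set of the positions
   whose entry is barred. *)
Definition bdinv gam bars pi : nat :=
  (#|[pred p : 'I_n * 'I_n |
       [&& p.1 < p.2, gam p.1 == gam p.2 & pi p.2 < pi p.1]]| +
   #|[pred p : 'I_n * 'I_n |
       [&& p.1 < p.2, (gam p.1 + 1)%N == gam p.2, pi p.1 < pi p.2
         & p.2 \notin bars]]|)%N.

Definition zero_vec : {ffun 'I_n -> bool} := [ffun=> false].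

Definition fubini gam : Prop :=
  forall k : nat, (k <= \max_(i < n) gam i)%N -> exists i, gam i = k.

Definition associated v gam : Prop :=
  (v = zero_vec /\ forall i, gam i = 0%N <-> nat_of_ord i = 0%N) \/
  (v <> zero_vec /\ forall i, gam i = 0%N <-> v i = true).

Definition may_be_barred gam (j : 'I_n) : Prop :=
  [/\ (0 < gam j)%N,
      #|[pred i | gam i == gam j]| = 1%N
    & forall i : 'I_n, (i < j)%N -> (gam i < gam j)%N].

Definition barred_fubini v : set (word n * {set 'I_n}) :=
  [set w : word n * {set 'I_n} |
    [/\ fubini w.1, associated v w.1
      & forall j, j \in w.2 -> may_be_barred w.1 j]].

(* The words over the positive integers. *)
Definition posword : set (word n) :=
  [set pi : word n | forall i, (0 < pi i)%N].

Definition L_index v : set (word n) :=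
  [set gam : word n | forall i, gam i = 0%N <-> v i = true].

Definition L v : qtx_series :=
  fps_sum (L_index v `*` posword)
    (fun '(gam, pi) => q_ ^+ area gam * t_ ^+ dinv gam pi * xpow pi).

(* All the families summed here are summable, so the convention of fps_sum on
   infinite supports is never used. *)

Lemma finite_bounded_words (N : nat) :
  finite_set [set gam : word n | forall i, (gam i <= N)%N].
Proof.
pose g (h : {ffun 'I_n -> 'I_N.+1}) : word n := [ffun i => h i : nat].
apply: (@sub_finite_set _ _ (g @` [set: {ffun 'I_n -> 'I_N.+1}])).
  move=> gam gamN; exists [ffun i => inord (gam i)] => //.
  by apply/ffunP => i; rewrite !ffunE inordK // ltnS; apply: gamN.
exact/finite_image/finite_finset.
Qed.

Lemma finite_xpow (m : {cmonom var}) :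
  finite_set [set pi : word n | exists a b : {cmonom var},
                (a * b)%M = m /\ (xpow pi) a != 0].
Proof.
pose ix (u : var) := if u is Vx k then k else 0%N.
pose N := (\max_(u : finsupp m) ix (val u))%N.
apply: (sub_finite_set _ (finite_bounded_words N)) => pi [a [b [abm pia]]] i.
have mi : Vx (pi i) \in finsupp m.
  rewrite -cmE_neq0 -abm cmM -lt0n addn_gt0; apply/orP; left.
  move: pia; rewrite /xpow (bigD1 i) //= => /fps_mul_supp[c [d [<- xc _]]].
  rewrite cmM addn_gt0; apply/orP; left.
  by apply: (@fps_varX_supp int _ _ 1%N); rewrite expr1.
exact: (leq_bigmax (F := fun u : finsupp m => ix (val u)) [` mi]%fset).
Qed.

Lemma area_ge gam i : (gam i <= (area gam).+1)%N.
Proof.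
have -> : area gam = (\sum_(j < n) (gam j).-1)%N.
  rewrite /area -sum1_card [X in (_ - X)%N]big_mkcond /=.
  apply/eqP; rewrite -(eqn_add2r (\sum_(j < n) (if (0 < gam j)%N then 1 else 0))).
  rewrite -big_split /= subnK; last first.
    by apply: leq_sum => j _; rewrite inE; case: (gam j).
  apply/eqP/eq_bigr => j _; case: (gam j) => //= k.
  by rewrite addn1.
by rewrite (bigD1 i) //=; case: (gam i) => //= k; rewrite ltnS leq_addr.
Qed.

Lemma L_summable v :
  fps_summable (L_index v `*` posword)
    (fun '(gam, pi) => q_ ^+ area gam * t_ ^+ dinv gam pi * xpow pi).
Proof.
move=> m; apply: (sub_finite_set _
  (finite_setX (finite_bounded_words (m Vq).+1) (finite_xpow m))).
move=> [gam pi] [_ /= /fps_mul_supp[a [b [abm qa xb]]]]; split=> /=.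
  move=> i; apply: leq_trans (area_ge gam i) _; rewrite ltnS -abm cmM.
  apply: leq_trans (leq_addr _ _).
  move: qa => /fps_mul_supp[c [d [<- qc _]]]; rewrite cmM.
  by apply: leq_trans (leq_addr _ _); apply: fps_varX_supp qc.
by exists b, a; rewrite mulmC.
Qed.

Lemma fubini_lt gam i : fubini gam -> (gam i < n)%N.
Proof.
set N := (\max_(i < n) gam i)%N => fgam.
have ex (k : 'I_N.+1) : exists j, gam j == k.
  by have [j <-] := fgam k (ltn_ord k); exists j.
pose g k := xchoose (ex k).
have gK k : gam (g k) = k by apply/eqP/(xchooseP (ex k)).
have g_inj : injective g by move=> k l kl; apply: val_inj; rewrite /= -!gK kl.
have := leq_card g g_inj; rewrite !card_ord; apply: leq_trans.
exact: (leq_bigmax (F := fun i => gam i)).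
Qed.

Lemma barred_summable v :
  fps_summable (barred_fubini v `*` posword)
    (fun '((gam, bars), pi) =>
       q_ ^+ (area gam + #|bars|) * t_ ^+ bdinv gam bars pi
         * inv_1q ^+ (#|bars| + (v == zero_vec)) * xpow pi).
Proof.
move=> m; apply: (sub_finite_set _ (finite_setX
  (finite_setX (finite_bounded_words n) (@finite_finset {set 'I_n} setT))
  (finite_xpow m))).
move=> [[gam bars] pi] [[[/= fgam _ _] _] /fps_mul_supp[a [b [abm _ xb]]]].
split=> /=; first by split=> // i /=; apply/ltnW/fubini_lt.
by exists b, a; rewrite mulmC.
Qed.

End Words.

Lemma inv_1q_summable : fps_summable [set: nat] (fun k => q_ ^+ k).
Proof.
move=> m; apply: (sub_finite_set _ (finite_II (m Vq).+1)) => k [_ qk] /=.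
by rewrite ltnS; apply: fps_varX_supp qk.
Qed.

(* Main.v *)
(* Cut a word at a height k and let H be the set of positions of its entries
   that are at least k.  Rotating the subword on H (its first letter moves to the
   end and is increased by 1, the letters of pi move along) adds 1 to the area and
   preserves dinv, as long as no entry of H interacts with an entry below k.
   Rotation is injective; on the words that skip the value k but reach above it,
   the only words it fails to hit are the images of the words whose first entry
   in H is the unique occurrence of k.  Hence W = q W + Y for the two generating
   functions, so a gap at k is worth one factor 1 / (1 - q) and one entry k that
   does not count in dinv with the entries k - 1: a barred entry.  Removing the
   gaps from the bottom up turns all words into barred Fubini words.  When
   v = 0^n, the same rotation with k = 0 first reduces to the words whose only 0
   is the first entry, which gives the extra factor. *)
Require Import Defs.
From mathcomp Require Import all_boot all_order all_algebra.
From mathcomp Require Import finmap.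
From mathcomp Require Import mathcomp_extra boolp classical_sets functions.
From mathcomp Require Import cardinality fsbigop monalg.
Import GRing.Theory.
Local Open Scope classical_set_scope.
Local Open Scope ring_scope.

(** * Infinite sums of power series *)

Section FpsSum.
Context {R : comNzRingType} {I J : choiceType}.
Implicit Types (A B : set J) (F : J -> fps R I) (g : fps R I).

Lemma fps_summable_sub {A B F} : A `<=` B ->
  fps_summable B F -> fps_summable A F.
Proof.
move=> AB sB m; apply: sub_finite_set (sB m) => j [/AB Bj Fj].
by split.
Qed.

(** Summability is essential: an infinite support gives the coefficient 0 by convention, while one
    of the two parts could be finite with a nonzero sum. *)
Lemma fps_sumID A B F : fps_summable A F ->
  fps_sum A F = fps_sum (A `&` B) F + fps_sum (A `&` ~` B) F.
Proof.
move=> sA; apply/funext => m; rewrite [RHS]/GRing.add /= /fps_sum.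
set S := [set j | A j /\ F j m != 0].
have supp C : C `<=` A ->
    \sum_(j \in C) F j m = \sum_(j \in S `&` C) F j m.
  move=> CA; apply/esym/fsbig_widen => [j []//|j [Cj nS]] /=.
  by apply/eqP/negPn/negP => Fj; apply: nS; split=> //; split=> //; apply: CA.
rewrite supp // [X in _ = X + _]supp; last by move=> j [].
rewrite [X in _ = _ + X]supp; last by move=> j [].
have SA : S `&` A = S by apply/setIidl => j [].
by rewrite !setIA SA (fsbigID B) //; apply: sA.
Qed.

Lemma eq_fps_sum A F F' : (forall j, A j -> F j = F' j) ->
  fps_sum A F = fps_sum A F'.
Proof.
by move=> FF'; apply/funext => m; apply: eq_fsbigr => j; rewrite inE => /FF' ->.
Qed.

(** A monomial has finitely many factorizations, and each second factor meets the support of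
    finitely many [F j]; the two sums are thus finite and can be exchanged. *)
Lemma fps_sumM g A F : fps_summable A F ->
  g * fps_sum A F = fps_sum A (fun j => g * F j).
Proof.
move=> sA; apply/funext => m.
rewrite [LHS]/GRing.mul /= /fps_mul /fps_sum.
set P := [set p : {cmonom I} * {cmonom I} | _].
have finP : finite_set P := finite_factors m.
set S := \bigcup_(p in P) [set j | A j /\ F j p.2 != 0].
have finS : finite_set S by apply: bigcup_finite => // p _; apply: sA.
have SA : S `<=` A by move=> j [p _ []].
have S0 j p : P p -> (A `\` S) j -> F j p.2 = 0.
  move=> Pp [Aj nSj]; apply/eqP/negPn/negP => Fj; apply: nSj.
  by exists p => //; split.
transitivity (\sum_(p \in P) \sum_(j \in S) g p.1 * F j p.2).
  apply: eq_fsbigr => p; rewrite inE => Pp.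
  rewrite -(fsbig_widen S) //; last by move=> j /(S0 _ _ Pp).
  by rewrite fsbig_distrr.
rewrite exchange_fsbig //; apply: fsbig_widen => // j Sj /=.
by apply: fsbig1 => p Pp; rewrite (S0 j p) // mulr0.
Qed.

End FpsSum.

Lemma reindex_fps_sum {R : comNzRingType} {I J K : choiceType} (h : J -> K)
    {A : set J} {B : set K} {F : K -> fps R I} :
  set_bij A B h -> fps_sum B F = fps_sum A (F \o h).
Proof. by move=> hAB; apply/funext => m; apply: reindex_fsbig. Qed.

Lemma fps_sum_set1 {R : comNzRingType} {I J : choiceType} (j : J)
  (F : J -> fps R I) : fps_sum [set j] F = F j.
Proof. by apply/funext => m; rewrite /fps_sum fsbig_set1. Qed.

Lemma inv_1qE : inv_1q = 1 + q_ * inv_1q.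
Proof.
rewrite {1}/inv_1q (fps_sumID _ [set 0%N]) ?setTI; last exact: inv_1q_summable.
rewrite fps_sum_set1 expr0 fps_sumM; last exact: inv_1q_summable.
congr (_ + _); rewrite (reindex_fps_sum S (A := [set: nat])).
  by apply: eq_fps_sum => k _; rewrite /= exprS.
split=> //; [by move=> ? ? _ _ []|].
by case=> [[]|k _] //; exists k.
Qed.

(** The first equation says that [c] inverts [1 - a], so the second one is solved without
    division. *)
Lemma geometric_solution {S : comNzRingType} {a c w y : S} :
  c = 1 + a * c -> w = a * w + y -> w = c * y.
Proof.
move=> cE wE; have -> : y = (1 - a) * w by rewrite mulrBl mul1r {1}wE addrC addKr.
by rewrite mulrA mulrBr mulr1 {1}cE [c * a]mulrC addrK mul1r.
Qed.

(** Reindexing the sum over [B] along [r] yields [q_] times the same sum, from [B], plus the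
    contribution of [C]; the resulting equation is then solved. *)
Lemma cycling_sum {J : choiceType} {B C : set J} {F : J -> qtx_series}
    {r : J -> J} :
  fps_summable B F -> B `&` C = set0 -> set_bij (B `|` C) B r ->
  (forall x, B x -> F (r x) = q_ * F x) ->
  fps_sum B F = fps_sum C (fun x => inv_1q * F (r x)).
Proof.
move=> sB BC0 bij_r FB.
(* Since [r] is injective, the support of a coefficient of [F \o r] has the cardinality of its
   image, which lies in the support of [F] on [B]. *)
have sr : fps_summable (B `|` C) (F \o r).
  case: bij_r => rfun rinj rsurj m.
  have : {in (B `|` C) `&` [set j | F (r j) m != 0] &, injective r}.
    by move=> x y /set_mem[xBC _] /set_mem[yBC _]; apply: rinj; rewrite inE.
  move=> /inj_card_eq/eq_finite_set <-.
  by apply: sub_finite_set (sB m) => _ [x [xBC Fx] <-]; split=> //; apply: rfun.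
have EB : fps_sum B F = q_ * fps_sum B F + fps_sum C (F \o r).
  rewrite {1}(reindex_fps_sum r bij_r) (fps_sumID _ B) //; congr (_ + _).
    rewrite fps_sumM //; have -> : (B `|` C) `&` B = B.
      by rewrite setIUl setIid setIC BC0 setU0.
    by apply: eq_fps_sum.
  congr fps_sum; apply/seteqP; split=> [x [[Bx|//] nB]|x Cx]; first by case: nB.
  split; [by right|move=> Bx].
  by have: (B `&` C) x by []; rewrite BC0.
rewrite -fps_sumM; last by apply: fps_summable_sub sr; apply: subsetUr.
exact: geometric_solution inv_1qE EB.
Qed.
(** * Rotation of a subword *)

Section Rotation.
Context {n : nat}.
Implicit Types (H : {set 'I_n}) (i j : 'I_n) (gam pi : word n) (bars : {set 'I_n}).

(** * Cyclic successor within a set of positions *)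

Definition isfirst H i := (i \in H) && [forall j in H, i <= j]%N.

(** [next] wraps around from the last position of [H] to the first and fixes the positions outside
    [H], so this is a permutation of all positions. *)
Definition succ_in H := next (enum H).
Definition pred_in H := prev (enum H).

Lemma isfirstP {H i} :
  reflect (i \in H /\ forall j, j \in H -> (i <= j)%N) (isfirst H i).
Proof. by apply: (iffP andP) => -[iH /forall_inP]. Qed.

Lemma isfirst_eq {H i j} : isfirst H i -> isfirst H j -> i = j.
Proof.
move=> /isfirstP[iH ile] /isfirstP[jH jle].
by apply/val_inj/eqP; rewrite eqn_leq ile // jle.
Qed.

Lemma ex_isfirst {H i} : i \in H -> exists j, isfirst H j.
Proof.
by move=> iH; case: (arg_minnP val iH) => j jH jle; exists j; apply/isfirstP.
Qed.

Lemma sum_isfirst {H i} : i \in H -> (\sum_(j < n) isfirst H j = 1)%N.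
Proof.
move=> /ex_isfirst[f Hf]; rewrite (bigD1 f) //= Hf big1 // => j jf.
by case: (boolP (isfirst H j)) => // /(isfirst_eq Hf) fj; rewrite fj eqxx in jf.
Qed.

Lemma succ_inK H : cancel (succ_in H) (pred_in H).
Proof. exact/prev_next/enum_uniq. Qed.

Lemma pred_inK H : cancel (pred_in H) (succ_in H).
Proof. exact/next_prev/enum_uniq. Qed.

Lemma mem_succ_in H i : (succ_in H i \in H) = (i \in H).
Proof. by rewrite -mem_enum mem_next mem_enum. Qed.

Lemma mem_pred_in H i : (pred_in H i \in H) = (i \in H).
Proof. by rewrite -mem_enum mem_prev mem_enum. Qed.

Lemma succ_in_id {H i} : i \notin H -> succ_in H i = i.
Proof. by move=> iH; rewrite /succ_in next_nth mem_enum (negbTE iH). Qed.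

Lemma sorted_enum H : sorted (fun i j => (i < j)%N) (enum H).
Proof.
have: sorted ltn (map val (enum 'I_n)) by rewrite val_enum_ord iota_ltn_sorted.
rewrite sorted_map => srt.
rewrite enumT in srt; rewrite /enum_mem.
by apply: sorted_filter srt => i j k /=; apply: ltn_trans.
Qed.

(** In the increasing list of [H] the successor moves one index up, and only the last position wraps
    around; [i] is not last because [j] follows it. *)
Lemma succ_in_lt {H i j} : i \in H -> j \in H -> (i < j)%N ->
  ~~ isfirst H (succ_in H i) /\
  (isfirst H (succ_in H j) \/ (succ_in H i < succ_in H j)%N).
Proof.
have tr : transitive (fun i j : 'I_n => (i < j)%N).
  by move=> a b c; apply: ltn_trans.
have := sorted_enum H; have := mem_enum H.
rewrite /succ_in !next_nth; case: (enum H) => [memH _ iH|y s memH srt iH jH ij].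
  by have := memH i; rewrite iH.
rewrite !memH iH jH.
have [iy jy] : (i \in y :: s) /\ (j \in y :: s) by rewrite !memH.
have idx : (index i (y :: s) < index j (y :: s))%N.
  rewrite ltnNge leq_eqVlt; apply/negP => /orP[/eqP e|].
    have := congr1 (nth y (y :: s)) e; rewrite !nth_index // => E.
    by rewrite E ltnn in ij.
  by move=> /(sorted_ltn_index tr srt)-/(_ jy iy) /(ltn_trans ij); rewrite ltnn.
have jsz : (index j (y :: s) <= size s)%N by rewrite -ltnS -index_mem in jy *.
have nthS k : nth y s k = nth y (y :: s) k.+1 by [].
have first_y : isfirst H y.
  apply/isfirstP; split; first by rewrite -memH inE eqxx.
  move=> k; rewrite -memH inE => /orP[/eqP->//|ks].
  by apply/ltnW; move: (order_path_min tr srt) => /allP/(_ k ks).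
split.
  apply/negP => /(isfirst_eq first_y) E.
  have : (nth y (y :: s) 0 < nth y (y :: s) (index i (y :: s)).+1)%N.
    apply: (sorted_ltn_nth tr y srt) => //.
    by rewrite inE /= ltnS; apply: leq_trans idx jsz.
  by rewrite -nthS -E ltnn.
(* If [j] is last, its index overruns the tail [s] and [nth] returns the default [y], the first
   position of [H]. *)
move: jsz; rewrite leq_eqVlt => /orP[/eqP E|jlt]; [left|right].
  by rewrite E nth_default.
rewrite !nthS; apply: (sorted_ltn_nth tr y srt) => //; rewrite !inE /= !ltnS.
by apply: leq_trans idx (ltnW jlt).
Qed.

(** The contribution of a pair to [bdinv], freed from the condition [i < j] so that the order of
    positions can be handled separately. *)
Definition att (gam : word n) (bars : {set 'I_n}) (pi : word n) i j : nat :=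
  ((gam i == gam j) && (pi j < pi i)%N +
   [&& (gam i + 1)%N == gam j, (pi i < pi j)%N & j \notin bars])%N.

Definition att_sym gam bars pi i j : nat :=
  ((i < j) * att gam bars pi i j + (j < i) * att gam bars pi j i)%N.

Lemma card_pairE (P : pred ('I_n * 'I_n)) :
  #|P| = (\sum_(i < n) \sum_(j < n) P (i, j))%N.
Proof.
rewrite -sum1_card big_mkcond /= pair_bigA /=.
by apply: eq_bigr => -[i j] _ /=; case: ifP; rewrite unfold_in => ->.
Qed.

(* The symmetrization makes the count invariant under relabelling positions. *)
Lemma bdinvE gam bars pi :
  (bdinv gam bars pi).*2 = (\sum_(i < n) \sum_(j < n) att_sym gam bars pi i j)%N.
Proof.
have -> : bdinv gam bars pi =
    (\sum_(i < n) \sum_(j < n) (i < j) * att gam bars pi i j)%N.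
  rewrite /bdinv !card_pairE -big_split; apply: eq_bigr => i _.
  rewrite -big_split; apply: eq_bigr => j _ /=; rewrite /att.
  by case: (i < j)%N; rewrite ?mul1n ?mul0n.
rewrite -addnn [X in (_ + X)%N]exchange_big -big_split.
by apply: eq_bigr => i _; rewrite -big_split.
Qed.

Lemma dinvE gam pi : dinv gam pi = bdinv gam finset.set0 pi.
Proof.
rewrite /dinv /bdinv; congr (_ + _)%N; apply: eq_card => p.
by rewrite !inE andbT.
Qed.

(** * Rotated words and their inverses *)

Definition rot H (gam : word n) : word n :=
  [ffun i => (gam (succ_in H i) + isfirst H (succ_in H i))%N].

Definition unrot H (gam : word n) : word n :=
  [ffun i => (gam (pred_in H i) - isfirst H i)%N].

Definition shuffle H (pi : word n) : word n := [ffun i => pi (succ_in H i)].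

Definition unshuffle H (pi : word n) : word n := [ffun i => pi (pred_in H i)].

Definition high k (gam : word n) : {set 'I_n} :=
  finset.finset (fun i => k <= gam i)%N.

(** What rotation at height [k] and its inverse have in common; properties that only see the entries
    below [k] are transported along it. *)
Definition low_eq k gam (gam' : word n) :=
  forall i, if (gam i < k)%N then gam' i = gam i else (k <= gam' i)%N.

Lemma mem_high k gam i : (i \in high k gam) = (k <= gam i)%N.
Proof. by rewrite finset.in_set. Qed.

Lemma low_eq_high {k gam gam'} : low_eq k gam gam' ->
  high k gam' = high k gam.
Proof.
move=> lgg; apply/finset.setP => i; rewrite !mem_high.
by have := lgg i; case: (ltnP (gam i) k) => [lk ->|//]; rewrite leqNgt lk.
Qed.

Lemma isfirst_mem {H i} : isfirst H i -> i \in H.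
Proof. by case/andP. Qed.

Lemma isfirst_notin {H i} : i \notin H -> isfirst H i = false.
Proof. by rewrite /isfirst => /negbTE ->. Qed.

Lemma low_eq_rot k gam : low_eq k gam (rot (high k gam) gam).
Proof.
move=> i; rewrite ffunE; case: ltnP => [lk|kg].
  have iH : i \notin high k gam by rewrite mem_high -ltnNge.
  by rewrite succ_in_id // isfirst_notin // addn0.
by apply: leq_trans (leq_addr _ _); rewrite -mem_high mem_succ_in mem_high.
Qed.

(** As [k] is missing, the entries on [high k gam] exceed [k], and the one that is lowered by 1
    stays at least [k]. *)
Lemma low_eq_unrot {k gam} : (forall i, gam i <> k) ->
  low_eq k gam (unrot (high k gam) gam).
Proof.
move=> gk i; rewrite ffunE; case: ltnP => [lk|kg].
  have iH : i \notin high k gam by rewrite mem_high -ltnNge.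
  by rewrite -{1}(succ_in_id iH) succ_inK isfirst_notin // subn0.
have : (k <= gam (pred_in (high k gam) i))%N.
  by rewrite -mem_high mem_pred_in mem_high.
rewrite leq_eqVlt => /orP[/eqP/esym/gk//|lk].
by case: (isfirst _ _); rewrite ?subn0 ?subn1; [case: (gam _) lk|apply: ltnW].
Qed.

Lemma rotK H : cancel (rot H) (unrot H).
Proof. by move=> gam; apply/ffunP => i; rewrite !ffunE pred_inK addnK. Qed.

Lemma unrotK H gam : (forall i, i \in H -> (0 < gam i)%N) ->
  rot H (unrot H gam) = gam.
Proof.
move=> gpos; apply/ffunP => i; rewrite !ffunE succ_inK.
case: (boolP (isfirst _ _)) => [/isfirst_mem|]; last by rewrite subn0 addn0.
by rewrite mem_succ_in => /gpos; case: (gam i) => // m; rewrite subn1 addn1.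
Qed.

Lemma shuffleK H : cancel (shuffle H) (unshuffle H).
Proof. by move=> pi; apply/ffunP => i; rewrite !ffunE pred_inK. Qed.

Lemma unshuffleK H : cancel (unshuffle H) (shuffle H).
Proof. by move=> pi; apply/ffunP => i; rewrite !ffunE succ_inK. Qed.

Lemma succ_in_bij H : bijective (succ_in H).
Proof. by exists (pred_in H); [apply: succ_inK|apply: pred_inK]. Qed.

Lemma xpow_shuffle H pi : xpow (shuffle H pi) = xpow pi.
Proof.
rewrite /xpow [RHS](reindex (succ_in H)); last first.
  by apply: onW_bij; apply: succ_in_bij.
by apply: eq_bigr => i _; rewrite ffunE.
Qed.

(** * Area of a rotated word *)

Lemma areaE gam : area gam = (\sum_(i < n) (gam i).-1)%N.
Proof.
rewrite /area -sum1_card [X in (_ - X)%N]big_mkcond /=.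
rewrite -sumnB => [|i _]; last by rewrite inE; case: (gam i).
by apply: eq_bigr => i _; rewrite inE; case: (gam i) => // m; rewrite subn1.
Qed.

Lemma area_rotE H gam :
  area (rot H gam) = (\sum_(i < n) (gam i + isfirst H i).-1)%N.
Proof.
rewrite areaE [RHS](reindex (succ_in H)); last first.
  by apply: onW_bij; apply: succ_in_bij.
by apply: eq_bigr => i _; rewrite ffunE.
Qed.

Lemma area_rot H gam i : i \in H -> (forall j, j \in H -> (0 < gam j)%N) ->
  area (rot H gam) = (area gam).+1.
Proof.
move=> iH gpos; rewrite area_rotE areaE -addn1 -(sum_isfirst iH) -big_split.
apply: eq_bigr => j _ /=; case: (boolP (isfirst H j)) => [/isfirst_mem/gpos|_].
  by case: (gam j) => // m; rewrite addn1 /= addn1.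
by rewrite !addn0.
Qed.

(** The raised letter goes from 0 to 1, and both values contribute 0 to the area. *)
Lemma area_rot0 H gam : (forall j, isfirst H j -> gam j = 0%N) ->
  area (rot H gam) = area gam.
Proof.
move=> g0; rewrite area_rotE areaE; apply: eq_bigr => j _.
case: (boolP (isfirst H j)) => [/g0->//|_]; by rewrite addn0.
Qed.

(** * Invariance of dinv under rotation *)

Lemma att_symC gam bars pi i j :
  att_sym gam bars pi i j = att_sym gam bars pi j i.
Proof. by rewrite /att_sym addnC. Qed.

Lemma att_sym_lt gam bars pi i j : (i < j)%N ->
  att_sym gam bars pi i j = att gam bars pi i j.
Proof. by move=> ij; rewrite /att_sym ij ltnNge ltnW //= mul0n mul1n addn0. Qed.

(** Across height [k] the only values that could interact are [k - 1] and [k], and there the bar on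
    [j] cancels the contribution. *)
Lemma att_low_high gam bars pi k i j : (gam i < k <= gam j)%N ->
    (gam j = k -> j \in bars) ->
  att gam bars pi i j = 0%N /\ att gam bars pi j i = 0%N.
Proof.
move=> /andP[ik kj] jbar; have ij := leq_trans ik kj; rewrite /att.
have ji1 : (gam j + 1)%N == gam i = false by rewrite gtn_eqF // addn1 ltnW.
rewrite (ltn_eqF ij) (gtn_eqF ij) ji1 /= addn1.
split=> //; case: eqP => //= ijE; rewrite jbar ?andbF //.
by apply/eqP; rewrite eqn_leq kj andbT -ijE.
Qed.

(** A bar on [j] matters only if [gam j = gam i + 1], which exceeds [k] and hence every barred
    entry. *)
Lemma att_high gam bars pi k i j : (forall l, l \in bars -> (gam l <= k)%N) ->
  (k <= gam i)%N -> att gam bars pi i j = att gam finset.set0 pi i j.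
Proof.
move=> barsk ki; rewrite /att finset.in_set0.
case: ((gam i + 1)%N =P gam j) => //= ijE.
suff /negbTE-> : j \notin bars by [].
by apply/negP => /barsk; rewrite -ijE leqNgt addn1 ltnS ki.
Qed.

(* Restricted to k > 0 because an entry 0 is never barred. *)
Definition level k gam : {set 'I_n} :=
  finset.finset (fun i => (0 < k)%N && (gam i == k)).

Lemma mem_level k gam i : (i \in level k gam) = (0 < k)%N && (gam i == k).
Proof. by rewrite finset.in_set. Qed.

Lemma rot_gt {k gam i} : (forall j, gam j = k -> isfirst (high k gam) j) ->
  (k <= gam i)%N -> (k < rot (high k gam) gam i)%N.
Proof.
move=> gfirst; rewrite -mem_high -mem_succ_in ffunE => iH.
have : (k <= gam (succ_in (high k gam) i))%N by rewrite -mem_high.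
rewrite leq_eqVlt => /orP[/eqP kE|ki]; last exact: leq_trans ki (leq_addr _ _).
by rewrite gfirst // addn1 -kE.
Qed.

(** Mixed pairs contribute 0 on both sides and pairs outside [H] are untouched. Within [H] the order
    is kept unless [j] is the last position, whose successor is the first. *)
Lemma att_rot {gam bars pi k} (H := high k gam)
    (bars' := bars :\: level k gam) {i j} :
    (forall i, gam i = k -> (0 < k)%N -> i \in bars) ->
    (forall i, gam i = k -> isfirst H i) ->
    (forall i, i \in bars -> (0 < gam i <= k)%N) -> (i < j)%N ->
  att (rot H gam) bars' (shuffle H pi) i j =
  att_sym gam bars pi (succ_in H i) (succ_in H j).
Proof.
move=> barred gfirst barsk ij.
have rot_gt l : l \in H -> (k < rot H gam l)%N.
  by rewrite mem_high; apply: rot_gt.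
have barsk' l : l \in bars -> (gam l <= k)%N by move=> /barsk/andP[].
have memb' l : (l \in bars') = ~~ ((0 < k)%N && (gam l == k)) && (l \in bars).
  by rewrite finset.in_setD mem_level.
have rot_low l : l \notin H -> rot H gam l = gam l.
  by move=> lH; rewrite ffunE succ_in_id // isfirst_notin // addn0.
have sh_low l : l \notin H -> shuffle H pi l = pi l.
  by move=> lH; rewrite ffunE succ_in_id.
have cross l m bars0 : l \notin H -> m \in H ->
    att (rot H gam) bars0 (shuffle H pi) l m = 0%N /\
    att (rot H gam) bars0 (shuffle H pi) m l = 0%N.
  move=> lH mH; have mk := rot_gt m mH.
  apply: (@att_low_high _ _ _ k); last by move=> E; rewrite E ltnn in mk.
  by rewrite rot_low // (ltnW mk) andbT ltnNge -mem_high.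
have cross0 l m : l \notin H -> m \in H ->
    att_sym gam bars pi l m = 0%N.
  move=> lH mH; rewrite /att_sym.
  have [||-> ->] := @att_low_high gam bars pi k l m; last by rewrite !muln0.
    by rewrite -mem_high mH andbT ltnNge -mem_high.
  (* A position [l] outside [H] has an entry below [k], which forces [k] to be positive. *)
  move=> mE; apply: barred => //; rewrite lt0n; apply: contraNneq lH => k0.
  by rewrite mem_high k0.
case: (boolP (i \in H)) => iH; case: (boolP (j \in H)) => jH.
- have [Ni Nj] := succ_in_lt iH jH ij.
  have [iH' jH'] : succ_in H i \in H /\ succ_in H j \in H by rewrite !mem_succ_in.
  (* The bars left in [bars'] sit on entries below [k], so no pair within [H] sees them. *)
  have -> : att (rot H gam) bars' (shuffle H pi) i j =
            att (rot H gam) finset.set0 (shuffle H pi) i j.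
    apply: (@att_high _ _ _ k _ _ _ (ltnW (rot_gt i iH))) => l.
    rewrite memb' => /andP[lk /barsk/andP[l0 lek]].
    have k0 := leq_trans l0 lek; rewrite k0 /= in lk.
    have {}lk : (gam l < k)%N by rewrite ltn_neqAle lk.
    by rewrite rot_low; [apply: ltnW|rewrite mem_high -ltnNge].
  have jNi : succ_in H j != succ_in H i.
    by rewrite (can_eq (succ_inK H)) -val_eqE /= gtn_eqF.
  (* In the wrap-around case the letter that was first now comes last, one larger: pairs of equal
     values and pairs of consecutive values trade places, with matching conditions on [pi]. *)
  case: (boolP (isfirst H (succ_in H j))) => [fj|nfj].
    have ji : (succ_in H j < succ_in H i)%N.
      rewrite ltn_neqAle val_eqE jNi /=.
      by case/isfirstP: fj => _; apply.
    rewrite att_symC att_sym_lt //.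
    rewrite (@att_high _ _ _ k) //; last by rewrite -mem_high.
    rewrite /att !ffunE fj (negbTE Ni) addn0 !finset.in_set0 !andbT eqn_add2r.
    rewrite addnC [in LHS]eq_sym.
    by congr (_ + nat_of_bool (_ && _))%N; rewrite eq_sym.
  have {}ij : (succ_in H i < succ_in H j)%N by case: Nj => // fj; rewrite fj in nfj.
  rewrite att_sym_lt // [in RHS](@att_high _ _ _ k) //; last by rewrite -mem_high.
  by rewrite /att !ffunE (negbTE nfj) (negbTE Ni) !addn0 !finset.in_set0.
- by rewrite (cross _ _ _ jH iH).2 (succ_in_id jH) att_symC cross0 // mem_succ_in.
- by rewrite (cross _ _ _ iH jH).1 (succ_in_id iH) cross0 // mem_succ_in.
- rewrite !succ_in_id // att_sym_lt // /att !rot_low // !sh_low // memb'.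
  suff /negbTE-> : gam j != k by rewrite andbF.
  by move: jH; rewrite mem_high; apply: contraNneq => jk; rewrite jk.
Qed.

Lemma bdinv_rot {gam bars pi k} (H := high k gam) :
    (forall i, gam i = k -> (0 < k)%N -> i \in bars) ->
    (forall i, gam i = k -> isfirst H i) ->
    (forall i, i \in bars -> (0 < gam i <= k)%N) ->
  bdinv (rot H gam) (bars :\: level k gam) (shuffle H pi)
  = bdinv gam bars pi.
Proof.
move=> barred gfirst barsk; apply: double_inj; rewrite !bdinvE.
have bN := onW_bij predT (succ_in_bij H).
rewrite [RHS](reindex _ bN); apply: eq_bigr => i _.
rewrite [RHS](reindex _ bN); apply: eq_bigr => j _ /=.
case: (ltngtP i j) => ij.
- by rewrite att_sym_lt // att_rot.
- by rewrite att_symC att_sym_lt // att_rot // att_symC.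
- by rewrite (val_inj ij) /att_sym !ltnn.
Qed.

End Rotation.

Lemma set_bij_can {T U : Type} {A : set T} {B : set U} {f : T -> U} {g : U -> T} :
    set_fun A B f -> set_fun B A g ->
    (forall x, A x -> g (f x) = x) -> (forall y, B y -> f (g y) = y) ->
  set_bij A B f.
Proof.
move=> fAB gBA gf fg; split=> //.
- by move=> x y; rewrite !inE => /gf {2}<- /gf {2}<- ->.
- by move=> y By; exists (g y); [apply: gBA|apply: fg].
Qed.

(** * Removing the gaps *)

Section RingIdentities.
Context {S : comNzRingType}.
Implicit Types a b c d : S.

Lemma mulr_exprSl a b c d m :
  a ^+ m.+1 * b * c * d = a * (a ^+ m * b * c * d).
Proof. by rewrite exprS !mulrA. Qed.

Lemma mulr_exprSm a b c d m :
  a * (b * c * a ^+ m * d) = b * c * a ^+ m.+1 * d.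
Proof.
by rewrite exprS !mulrA; congr (_ * _ * _); rewrite -mulrA mulrC.
Qed.

End RingIdentities.

(** * Weights and the cycling map on barred words *)

Section Cycling.
Context {n : nat}.
Implicit Types (gam pi : word n) (bars : {set 'I_n}) (v : {ffun 'I_n -> bool}).

Notation triple := ((word n * {set 'I_n}) * word n)%type.
Implicit Types x y : triple.

(** The extra exponent [e] is a parameter because the reduction for the zero vector raises it from 0
    to 1. *)
Definition weight e : triple -> qtx_series := fun '((gam, bars), pi) =>
  q_ ^+ (area gam + #|bars|) * t_ ^+ bdinv gam bars pi
    * inv_1q ^+ (#|bars| + e) * xpow pi.

(** The exponent of q in a monomial bounds the area and with it all entries; the exponents of the x
    variables bound [pi]. No gap condition is involved, so any [A] will do. *)
Lemma weight_summable e (A : set triple) : fps_summable A (weight e).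
Proof.
move=> m; have fin := finite_setX (finite_setX
  (@finite_bounded_words n (m Vq).+1) (@finite_finset {set 'I_n} setT))
  (@finite_xpow n m).
apply: sub_finite_set fin.
move=> [[gam bars] pi] [_ /= /fps_mul_supp[a [b [abm qa xb]]]].
split=> /=; last by exists b, a; rewrite mulmC.
split=> // i /=; apply: leq_trans (area_ge gam i) _; rewrite ltnS -abm cmM.
move: qa => /fps_mul_supp[c [d [<- /fps_mul_supp[c' [d' [<- qc _]]] _]]].
rewrite !cmM -!addnA; apply: leq_trans (leq_addr _ _).
by apply: leq_trans (leq_addr _ _) (fps_varX_supp qc).
Qed.

Definition cycle k : triple -> triple := fun '((gam, bars), pi) =>
  ((rot (high k gam) gam, bars :\: level k gam), shuffle (high k gam) pi).

(** Whether [cycle] dropped a bar can be read off from the unrotated word: for positive [k], exactly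
    its entries [k] are barred again. *)
Definition uncycle k : triple -> triple := fun '((gam, bars), pi) =>
  ((unrot (high k gam) gam, bars :|: level k (unrot (high k gam) gam)),
   unshuffle (high k gam) pi).

(* k is missing from gam, or its only occurrence comes before all larger
   entries and is barred unless k = 0. *)
Definition cyclable k x : Prop :=
  [/\ forall i, x.1.1 i = k -> (0 < k)%N -> i \in x.1.2,
      forall i, x.1.1 i = k -> isfirst (high k x.1.1) i
    & forall i, i \in x.1.2 -> (0 < x.1.1 i <= k)%N].

Lemma cycleK k x : cyclable k x -> uncycle k (cycle k x) = x.
Proof.
case: x => [[gam bars] pi] [/= barred _ barsk].
rewrite (low_eq_high (low_eq_rot k gam)) rotK shuffleK; congr (_, _, _).
apply/finset.setP => i; rewrite finset.in_setU finset.in_setD mem_level.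
case: (boolP ((0 < k)%N && _)) => [/andP[k0 /eqP ik]|_] /=; last by rewrite orbF.
by rewrite barred.
Qed.

Lemma uncycleK k x : (forall i, x.1.1 i <> k) ->
  (forall i, i \in x.1.2 -> (x.1.1 i < k)%N) -> cycle k (uncycle k x) = x.
Proof.
case: x => [[gam bars] pi] /= gk barsk.
have lgg := low_eq_unrot gk.
rewrite (low_eq_high lgg) unshuffleK unrotK => [|i]; last first.
  by rewrite mem_high leq_eqVlt => /orP[/eqP/esym/gk//|]; apply: leq_ltn_trans.
congr (_, _, _); apply/finset.setP => i.
rewrite finset.in_setD finset.in_setU !mem_level.
case: (boolP ((0 < k)%N && _)) => [/andP[k0 /eqP ik]|_] /=; last by rewrite orbF.
apply/esym/negP => /barsk ilt; have := lgg i; rewrite ilt => E.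
by rewrite -E ik ltnn in ilt.
Qed.

Lemma weight_cycle e k gam bars pi (H := high k gam)
    (bars' := bars :\: level k gam) :
  cyclable k ((gam, bars), pi) ->
  weight e (cycle k ((gam, bars), pi)) =
  q_ ^+ (area (rot H gam) + #|bars'|) * t_ ^+ bdinv gam bars pi
    * inv_1q ^+ (#|bars'| + e) * xpow pi.
Proof. by case=> /= h1 h2 h3; rewrite xpow_shuffle bdinv_rot. Qed.

(** An entry [k] can only arise by lowering, which happens at the first position alone; the others
    receive letters of [gam], where [k] is missing. *)
Lemma isfirst_unrot {k gam i} : (forall j, gam j <> k) ->
  unrot (high k gam) gam i = k -> isfirst (high k gam) i.
Proof.
move=> gk ik.
have iH : i \in high k gam.
  by rewrite -(low_eq_high (low_eq_unrot gk)) mem_high ik.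
case: (boolP (isfirst _ _)) => // /negbTE nf.
have : pred_in (high k gam) i \in high k gam by rewrite mem_pred_in.
move: ik; rewrite ffunE nf subn0 mem_high => E.
by case: (gk _ E).
Qed.

(** * Removing one gap *)

Definition nogap k gam : Prop :=
  forall l, (l <= k)%N -> forall i, (l <= gam i)%N -> exists j, gam j = l.

(** Intermediate stages of the induction on height: up to [k] gaps are excluded and bars allowed,
    above [k] gaps are allowed and bars excluded. *)
Definition partial v k : set triple :=
  [set x : triple | [/\ associated v x.1.1, nogap k x.1.1,
    forall i, i \in x.1.2 -> may_be_barred x.1.1 i /\ (x.1.1 i <= k)%N
    & posword x.2]].

(** This set and [bar_at v k] serve as [B] and [C] in [cycling_sum], with rotation at height
    [k.+1]. *)
Definition gap_at v k : set triple :=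
  [set x : triple | [/\ partial v k x, exists i, (k < x.1.1 i)%N
    & forall i, x.1.1 i <> k.+1]].

Definition bar_at v k : set triple :=
  [set x : triple | partial v k.+1 x /\ exists2 i, i \in x.1.2 & x.1.1 i = k.+1].

(** [associated] depends only on the positions of the zeros, which lie below a positive [k]. *)
Lemma low_eq_associated {k v gam gam'} : (0 < k)%N -> low_eq k gam gam' ->
  associated v gam -> associated v gam'.
Proof.
move=> k0 lgg.
have zE i : gam' i = 0%N <-> gam i = 0%N.
  have := lgg i; case: ltnP => [_ ->//|kg kg'].
  by split=> E; [move: kg'|move: kg]; rewrite E leqNgt k0.
by case=> -[hv h]; [left|right]; split=> // i; rewrite -h.
Qed.

Lemma low_eq_nogap {k gam gam'} : low_eq k.+1 gam gam' ->
  nogap k gam -> nogap k gam'.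
Proof.
move=> lgg gg l lk i lg.
have [j gj] : exists j, gam j = l.
  apply: (gg l lk i); have := lgg i; case: ltnP => [_ <-//|kg _].
  by apply: leq_trans lk (ltnW kg).
by exists j; have := lgg j; rewrite gj ltnS lk.
Qed.

Lemma low_eq_may_be_barred {k gam gam' j} : low_eq k gam gam' ->
  (gam j < k)%N -> may_be_barred gam j -> may_be_barred gam' j.
Proof.
move=> lgg jk; have := lgg j; rewrite jk => jE [j0 j1 jlt].
split; rewrite jE //.
  rewrite -j1; apply: eq_card => i; rewrite !inE; have := lgg i.
  case: ltnP => [_ ->//|kg kg']; rewrite !gtn_eqF //; exact: leq_trans jk _.
move=> i /jlt ij; have := lgg i.
by rewrite (ltn_trans ij jk) => ->.
Qed.

Lemma cyclable_gap {v k x} : gap_at v k x -> cyclable k.+1 x.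
Proof.
case: x => [[gam bars] pi] [[_ _ /= barsk _] _ gk].
split=> /= i; try by move/gk.
by move=> /barsk[[-> _ _] /leqW].
Qed.

(** A legal bar makes [k.+1] occur once and puts only smaller entries before it, so its position is
    the first of [high k.+1]. *)
Lemma cyclable_bar {v k x} : bar_at v k x -> cyclable k.+1 x.
Proof.
case: x => [[gam bars] pi] [[_ _ /= barsk _] [j jbar jk]].
have [[_ j1 jlt] _] := barsk j jbar.
have uniq_j i : gam i = k.+1 -> i = j.
  move=> ik; have /card_le1P/(_ j) : (#|[pred i | gam i == gam j]| <= 1)%N.
    by rewrite j1.
  by rewrite inE eqxx => /(_ isT i); rewrite !inE ik jk eqxx => /esym/eqP.
split=> /= i.
- by move=> /uniq_j->.
- move=> /uniq_j->; apply/isfirstP; split=> [|l]; rewrite mem_high ?jk //.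
  by apply: contraTT; rewrite -!ltnNge -jk; apply: jlt.
- by move=> /barsk[[-> _ _]].
Qed.

Lemma partialS {v k x} : partial v k.+1 x ->
  associated v x.1.1 /\ nogap k x.1.1.
Proof. by case=> av ng _ _; split=> // l /leqW; apply: ng. Qed.

Lemma cycle_bij v k : set_bij (gap_at v k `|` bar_at v k) (gap_at v k) (cycle k.+1).
Proof.
have cyc x : (gap_at v k `|` bar_at v k) x -> cyclable k.+1 x.
  by case; [apply: cyclable_gap|apply: cyclable_bar].
apply: (set_bij_can (g := uncycle k.+1)).
- move=> x BCx; have cx := cyc x BCx.
  have [av ng mb px [i ki]] : [/\ associated v x.1.1, nogap k x.1.1,
      forall i, i \in x.1.2 -> may_be_barred x.1.1 i, posword x.2
      & exists i, (k < x.1.1 i)%N].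
    case: BCx => [[[av ng mb px] ex _]|[Px [j jb jk]]].
      by split=> // i /mb[].
    have [av ng] := partialS Px; case: Px => _ _ mb px.
    by split=> // [i /mb[]//|]; exists j; rewrite jk.
  case: x {BCx} cx av ng mb px ki => [[gam bars] pi] [/= barred gfirst barsk].
  move=> av ng mb px ki; have lgg := low_eq_rot k.+1 gam; split=> /=.
  + split=> /=.
    * exact: low_eq_associated lgg av.
    * exact: low_eq_nogap lgg ng.
    * move=> j; rewrite finset.in_setD mem_level /= => /andP[jk jb].
      have {}jk : (gam j < k.+1)%N.
        by rewrite ltn_neqAle jk; case/andP: (barsk j jb).
      split; first exact: (low_eq_may_be_barred lgg jk (mb j jb)).
      by have := lgg j; rewrite jk => ->.
    * by move=> j; rewrite ffunE; apply: px.
  + by exists i; have := lgg i; rewrite ltnNge ki.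
  + move=> j jk; have := lgg j; case: (ltnP (gam j) k.+1) => [lk E|kg _].
      by rewrite -E jk ltnn in lk.
    by have := rot_gt gfirst kg; rewrite jk ltnn.
- move=> [[gam bars] pi] [[/= av ng barsk px] [i ki] gk].
  have lgg := low_eq_unrot gk; have HE := low_eq_high lgg.
  set gam0 := unrot _ gam in lgg HE *.
  have av0 := low_eq_associated (ltn0Sn k) lgg av.
  have ng0 := low_eq_nogap lgg ng.
  have px0 : posword (unshuffle (high k.+1 gam) pi).
    by move=> j; rewrite ffunE; apply: px.
  have bars0 j : j \in bars -> may_be_barred gam0 j /\ (gam0 j <= k)%N.
    move=> /barsk[mb jk]; split; first exact: low_eq_may_be_barred lgg _ mb.
    by have := lgg j; rewrite ltnS jk => ->.
  have gfirst j : gam0 j = k.+1 -> isfirst (high k.+1 gam) j.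
    exact: isfirst_unrot.
  (* If unrotating creates an entry [k.+1], it sits at the first high position, so it is unique and
     may carry a bar; otherwise the gap persists. *)
  case: (pselect (exists j, gam0 j = k.+1)) => [[j jk]|nk]; [right|left].
    have mbk l : gam0 l = k.+1 -> may_be_barred gam0 l.
      move=> lk; have fl := gfirst l lk; split.
      + by rewrite lk.
      + rewrite -(card1 l); apply: eq_card => m; rewrite !inE.
        apply/eqP/eqP => [E|->//].
        by apply/esym/(isfirst_eq fl)/gfirst; rewrite E.
      + move=> m ml; rewrite lk ltnNge -mem_high HE; apply/negP => mH.
        by have /isfirstP[_ /(_ m mH)] := fl; rewrite leqNgt ml.
    split=> /=; last first.
      by exists j => //; rewrite finset.in_setU mem_level /= jk eqxx orbT.
    split=> //= [l|l].
      rewrite leq_eqVlt => /orP[/eqP->|]; last exact: ng0.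
      by move=> _ _; exists j.
    rewrite finset.in_setU mem_level /= => /orP[/bars0[? /leqW]//|/eqP lk].
    by rewrite lk; split=> //; apply: mbk.
  split=> /=.
  + split=> //= l; rewrite finset.in_setU mem_level /= => /orP[/bars0//|/eqP lk].
    by case: nk; exists l.
  + by exists i; have := lgg i; rewrite ltnNge ki.
  + by move=> l lk; apply: nk; exists l.
- by move=> x /cyc; apply: cycleK.
- by move=> x [[_ _ barsk _] _ gk]; apply: uncycleK => // i /barsk[].
Qed.

Lemma gap_bar_disjoint v k : gap_at v k `&` bar_at v k = set0.
Proof. by apply/seteqP; split=> // x [[_ _ gk] [_ [i _ /gk]]]. Qed.

Lemma weight_gap e k x i : cyclable k x -> (forall j, x.1.1 j <> k) ->
  (k <= x.1.1 i)%N -> weight e (cycle k x) = q_ * weight e x.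
Proof.
case: x => [[gam bars] pi] cx gk ki; rewrite weight_cycle //.
rewrite /= in gk ki *.
have -> : bars :\: level k gam = bars.
  apply/finset.setP => j; rewrite finset.in_setD mem_level.
  by case: eqP => [/gk//|_]; rewrite andbF.
rewrite (@area_rot _ _ _ i) ?mem_high // => [|j]; last first.
  by rewrite mem_high leq_eqVlt => /orP[/eqP/esym/gk//|]; apply: leq_ltn_trans.
by rewrite addSn; apply: mulr_exprSl.
Qed.

(** Cycling loses one bar and gains one unit of area: the power of [q_] is unchanged and exactly one
    factor [inv_1q] is lost. *)
Lemma weight_bar e v k x : bar_at v k x ->
  inv_1q * weight e (cycle k.+1 x) = weight e x.
Proof.
move=> bx; have := cyclable_bar bx; case: x bx => [[gam bars] pi] bx cx.
rewrite weight_cycle //; case: cx bx => /= barred gfirst _ [_ [/= i ib ik]].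
have bE : bars :\: level k.+1 gam = bars :\ i.
  apply/finset.setP => j; rewrite !finset.in_setD mem_level finset.in_set1 /=.
  congr (~~ _ && _); apply/eqP/eqP => [jk|->//].
  exact: isfirst_eq (gfirst j jk) (gfirst i ik).
rewrite (@area_rot _ _ _ i) ?mem_high ?ik // => [|j]; last first.
  by rewrite mem_high; case: (gam j).
rewrite bE (finset.cardsD1 i bars) ib add1n addnS !addSn.
exact: mulr_exprSm.
Qed.

Lemma partial_step e v k :
  fps_sum (partial v k) (weight e) = fps_sum (partial v k.+1) (weight e).
Proof.
rewrite (fps_sumID _ (gap_at v k)); last exact: weight_summable.
rewrite [RHS](fps_sumID _ (bar_at v k)); last exact: weight_summable.
congr (_ + _).
  have -> : partial v k `&` gap_at v k = gap_at v k by apply/setIidr => x [].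
  have -> : partial v k.+1 `&` bar_at v k = bar_at v k by apply/setIidr => x [].
  rewrite (cycling_sum (@weight_summable e _) (gap_bar_disjoint v k)
    (cycle_bij v k)).
    by apply: eq_fps_sum => x; apply: weight_bar.
  move=> x gx; have [_ [i ki] gk] := gx.
  by apply: (weight_gap _ _ _ i) => //; apply: cyclable_gap gx.
(* The remaining triples coincide: no gap at [k.+1] on one side, no bar at [k.+1] on the other. *)
congr fps_sum; apply/seteqP; split=> -[[gam bars] pi] [[/= av ng barsk px] nB].
- split; last by move=> [_ [/= i /barsk[_ +] ik]]; rewrite ik ltnn.
  split=> //= [l|i /barsk[? /leqW]//].
  rewrite leq_eqVlt => /orP[/eqP-> i ki|]; last exact: ng.
  apply/not_existsP => nk; apply: nB; split=> //=; by exists i.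
- split; last first.
    by move=> [_ [i ki] gk]; have [j /gk] := ng k.+1 (leqnn _) i ki.
  split=> //= [l /leqW|i ib]; first exact: ng.
  have [mb] := barsk i ib; rewrite leq_eqVlt => /orP[/eqP ik|//].
  by case: nB; split=> //; exists i.
Qed.

Lemma partial0E e v k :
  fps_sum (partial v 0) (weight e) = fps_sum (partial v k) (weight e).
Proof. by elim: k => // k ->; apply: partial_step. Qed.

Lemma nogap_fubini gam : (0 < n)%N -> nogap n gam <-> fubini gam.
Proof.
move=> n0; split=> [ng|fg l _ i lg]; last first.
  exact/fg/(leq_trans lg)/(leq_bigmax (F := fun i => gam i)).
have gn i : (gam i < n)%N.
  rewrite ltnNge; apply/negP => ni.
  (* Cutting all entries down to at most [n] gives a Fubini word, whose entries are below [n] by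
     [fubini_lt]; an entry of [gam] that is at least [n] would be cut to [n] itself. *)
  pose trunc : word n := [ffun i => minn (gam i) n].
  suff /(@fubini_lt _ _ i) : fubini trunc by rewrite ffunE (minn_idPr ni) ltnn.
  move=> l lmax; have ln : (l <= n)%N.
    by apply: leq_trans lmax _; apply/bigmax_leqP => j _; rewrite ffunE geq_minr.
  have [j gj] := ng l ln i (leq_trans ln ni).
  by exists j; rewrite ffunE gj; apply/minn_idPl.
have [i maxE] : {i | (\max_(i < n) gam i)%N = gam i}.
  by apply: eq_bigmax; rewrite card_ord.
by rewrite /fubini maxE => l li; apply: (ng l _ i li);
  apply: leq_trans li (ltnW (gn i)).
Qed.

Lemma partial_barred v : (0 < n)%N ->
  partial v n = barred_fubini v `*` posword.
Proof.
move=> n0; apply/seteqP; split=> -[[gam bars] pi] /=.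
  by move=> [av /nogap_fubini-/(_ n0) fg mb px]; split=> //; split=> // i /mb[].
move=> [[fg av mb] px]; split=> //; first by apply/nogap_fubini.
by move=> i /mb mi; split=> //; apply/ltnW/fubini_lt.
Qed.

(** * Starting point of the reduction, with the zero vector apart *)

Definition unbarred v : set triple :=
  [set x : triple | [/\ L_index v x.1.1, x.1.2 = finset.set0 & posword x.2]].

Lemma L_unbarred v : L v = fps_sum (unbarred v) (weight 0).
Proof.
pose h (p : word n * word n) : triple := ((p.1, finset.set0), p.2).
rewrite (reindex_fps_sum h (A := L_index v `*` posword)).
  apply: eq_fps_sum => -[gam pi] _; rewrite /h /= finset.cards0 !addn0.
  by rewrite expr0 mulr1 dinvE.
apply: (set_bij_can (g := fun x : triple => (x.1.1, x.2))).
- by move=> [gam pi] [].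
- by move=> x [].
- by case.
- by move=> [[gam bars] pi] [/= _ -> _].
Qed.

Lemma partial_bars0 v x : partial v 0 x -> x.1.2 = finset.set0.
Proof.
case=> _ _ mb _; apply/finset.setP => i; rewrite finset.in_set0.
by apply/negbTE/negP => /mb[[gi _ _]]; rewrite leqNgt gi.
Qed.

(** A nonzero [v] forces an entry 0, so there is no gap at height 0, and bars at height 0 are
    impossible. *)
Lemma unbarred_partial0 v : v <> zero_vec -> unbarred v = partial v 0.
Proof.
move=> v0; apply/seteqP; split=> -[[gam bars] pi].
- move=> [/= Lg -> px]; split=> //=; first by right.
    move=> l; rewrite leqn0 => /eqP-> _ _.
    have [j vj] : exists j, v j = true.
      apply/not_existsP => nv; apply: v0; apply/ffunP => j; rewrite ffunE.
      by apply/negbTE/negP => /nv.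
    by exists j; apply/Lg.
  by move=> i; rewrite finset.in_set0.
- move=> Px; split; [|exact: partial_bars0 Px|by case: Px].
  by case: Px => -[[]|[]].
Qed.

Lemma partial_zero_vec {gam bars pi} : partial zero_vec 0 ((gam, bars), pi) ->
  forall i, gam i = 0%N <-> nat_of_ord i = 0%N.
Proof. by case=> /= [[[]|[]]]. Qed.

Lemma L_index_zero gam : L_index zero_vec gam <-> forall i, gam i <> 0%N.
Proof.
split=> [Lg i /Lg|g0 i]; rewrite ffunE // .
by split=> // /g0.
Qed.

Lemma isfirst_ord0 gam i : isfirst (high 0 gam) i <-> nat_of_ord i = 0%N.
Proof.
split=> [/isfirstP[_ imin]|i0]; last first.
  by apply/isfirstP; split=> [|j]; rewrite mem_high ?i0.
have n0 : (0 < n)%N by case: i imin => /= m mn _; apply: leq_ltn_trans mn.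
by apply/eqP; rewrite -leqn0; apply: (imin (Ordinal n0)); rewrite mem_high.
Qed.

Lemma level0 gam : level 0 gam = finset.set0.
Proof. by apply/finset.setP => i; rewrite [LHS]mem_level [RHS]finset.in_set0. Qed.

Lemma cyclable0 {x} :
  (unbarred zero_vec `|` partial zero_vec 0) x -> cyclable 0 x.
Proof.
case: x => [[gam bars] pi] BCx.
have bars0 : bars = finset.set0 by case: BCx => [[]|/partial_bars0].
split=> //= i; last by rewrite bars0 finset.in_set0.
move=> gi; apply/isfirst_ord0; case: BCx => [[/L_index_zero/(_ i)//]|].
by move=> /partial_zero_vec <-.
Qed.

(** Here [high 0] contains all positions. Unrotating a word without 0 either leaves it without 0 or
    creates a single 0, at the first position. *)
Lemma cycle0_bij :
  set_bij (unbarred zero_vec `|` partial zero_vec 0) (unbarred zero_vec)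
    (cycle 0).
Proof.
apply: (set_bij_can (g := uncycle 0)).
- move=> [[gam bars] pi] BCx; have [_ /= gfirst _] := cyclable0 BCx.
  have bars0 : bars = finset.set0 by case: BCx => [[]|/partial_bars0].
  have px : posword pi by case: BCx => -[].
  split=> /=.
  + by apply/L_index_zero => i /eqP; rewrite -leqn0 leqNgt rot_gt.
  + by rewrite bars0 finset.set0D.
  + by move=> i; rewrite ffunE; apply: px.
- move=> [[gam bars] pi] [/= /L_index_zero g0 bars0 px].
  have bars0' : bars :|: level 0 (unrot (high 0 gam) gam) = finset.set0.
    by rewrite bars0 level0 finset.setU0.
  have px0 : posword (unshuffle (high 0 gam) pi).
    by move=> i; rewrite ffunE; apply: px.
  have gfirst i : unrot (high 0 gam) gam i = 0%N -> nat_of_ord i = 0%N.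
    by move=> /(isfirst_unrot g0)/isfirst_ord0.
  case: (pselect (exists i, unrot (high 0 gam) gam i = 0%N)) => [[i gi]|ng].
    right; split=> //=.
    + left; split=> // j; split; first exact: gfirst.
      move=> j0; suff -> : j = i by [].
      by apply: val_inj; rewrite /= j0 gfirst.
    + by move=> l; rewrite leqn0 => /eqP-> _ _; exists i.
    + by move=> j; rewrite bars0' finset.in_set0.
  by left; split=> //=; apply/L_index_zero => i gi; apply: ng; exists i.
- by move=> x /cyclable0; apply: cycleK.
- move=> x [/L_index_zero g0 bars0 px]; apply: uncycleK => // i.
  by rewrite bars0 finset.in_set0.
Qed.

Lemma unbarred_zero_vec : (0 < n)%N ->
  fps_sum (unbarred zero_vec) (weight 0) =
  fps_sum (partial zero_vec 0) (weight 1).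
Proof.
move=> n0; rewrite (cycling_sum (weight_summable _ _) _ cycle0_bij).
- apply: eq_fps_sum => -[[gam bars] pi] Px.
  rewrite weight_cycle; last by apply: cyclable0; right.
  (* The initial 0 becomes 1 at no cost in area, so the factor [inv_1q] comes without a power of
     [q_] and raises [e] from 0 to 1. *)
  rewrite level0 finset.setD0 area_rot0 => [|i /isfirst_ord0]; last first.
    by move/(partial_zero_vec Px).
  by rewrite addn0 /weight addn1; apply: mulr_exprSm.
- apply/seteqP; split=> // -[[gam bars] pi] [[/L_index_zero g0 _ _]].
  by move=> /partial_zero_vec/(_ (Ordinal n0))[_ /(_ erefl)/g0].
- move=> x Bx; apply: (weight_gap _ _ _ (Ordinal n0)) => //.
    by apply: cyclable0; left.
  by apply/L_index_zero; case: Bx.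
Qed.

End Cycling.

Theorem theorem3p4 (n : nat) (v : {ffun 'I_n -> bool}) (hn : (1 <= n)%N) :
  L v =
  fps_sum (barred_fubini v `*` posword)
    (fun '((gam, bars), pi) =>
       q_ ^+ (area gam + #|bars|) * t_ ^+ bdinv gam bars pi
         * inv_1q ^+ (#|bars| + (v == zero_vec)) * xpow pi).
Proof.
rewrite -partial_barred //.
change (L v = fps_sum (partial v n) (weight (v == zero_vec))).
rewrite -partial0E L_unbarred; case: (eqVneq v zero_vec) => [->|/eqP v0].
  exact: unbarred_zero_vec.
by rewrite unbarred_partial0.
Qed.
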